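(* Let $\Phi$ be a balanced relative simplicial complex of dimension $d-1$ on vertex set $V$ with coloring $\kappa: V \to [d]$. Suppose that $\Phi$ satisfies Serre's condition $(S_\ell)$. Then for every $S \subseteq [d]$, the complex $\Phi|_S$ also satisfies Serre's condition $(S_\ell)$. Moreover, if $\Phi$ is relatively Cohen–Macaulay, then so is $\Phi|_S$ for every $S\subseteq[d]$.
   Context: A balanced relative simplicial complex of dimension $d-1$ on a finite vertex set $V$ is a nonempty collection $\Phi$ of subsets of $V$ (faces) together with a map $\kappa: V\to[d]=\{1,\dots,d\}$ such that: (i) if $\rho\subseteq\sigma\subseteq\tau$ with $\rho,\tau\in\Phi$ then $\sigma\in\Phi$; (ii) every $\rho\in\Phi$ is contained in some $\sigma\in\Phi$ with $|\sigma|=d$; (iii) $\kappa$ is injective on every face. Write $\kappa(\sigma)=\{\kappa(v):v\in\sigma\}$ and, for $S\subseteq[d]$, $\Phi|_S=\{\sigma\in\Phi:\kappa(\sigma)\subseteq S\}$. Any collection $\Psi$ of subsets of $V$ satisfying (i) is a relative complex: its reduced chain complex (coefficients in a fixed field) has in degree $i$ the basis of faces of $\Psi$ of cardinality $i+1$ (the empty face in degree $-1$ if $\emptyset\in\Psi$), with the usual simplicial boundary in which faces not in $\Psi$ are omitted; equivalently $\widetilde H_i(\Psi)=\widetilde H_i(\Delta,\Gamma)$ for any simplicial complexes $\Gamma\subseteq\Delta$ with $\Psi=\Delta\setminus\Gamma$. Its dimension is $\max\{|\tau|-1:\tau\in\Psi\}$. For $\sigma\subseteq V$, the link is $\mathrm{lk}_\Psi(\sigma)=\{\tau\subseteq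 V\setminus\sigma:\tau\cup\sigma\in\Psi\}$. $\Psi$ satisfies Serre's condition $(S_\ell)$ if $\widetilde H_{i-1}(\mathrm{lk}_\Psi(\sigma))=0$ for every $\sigma\subseteq V$ contained in some face of $\Psi$ and every integer $i\le\min(\dim\mathrm{lk}_\Psi(\sigma),\ell-1)$. $\Psi$ is relatively Cohen–Macaulay if it satisfies $(S_{\dim\Psi+1})$, i.e. $\widetilde H_{i-1}(\mathrm{lk}_\Psi(\sigma))=0$ for all such $\sigma$ and all $i\le\dim\mathrm{lk}_\Psi(\sigma)$. *)

(* Defs.v *)
From HB Require Import structures.
From mathcomp Require Import all_boot all_order all_algebra.

Set Implicit Arguments.
Unset Strict Implicit.
Unset Printing Implicit Defensive.

Import Order.TTheory GRing.Theory Num.Theory.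
Local Open Scope ring_scope.

Section RelativeComplex.

Variable V : finType.
Implicit Types (Psi : {set {set V}}) (rho sigma tau : {set V}).

Definition relative_complex Psi : Prop :=
  forall rho sigma tau, rho \subset sigma -> sigma \subset tau ->
    rho \in Psi -> tau \in Psi -> sigma \in Psi.

(* For Psi = set0 the value is -1; the notions below never depend on it,
   because set0 has no face. *)
Definition dim Psi : int := (\max_(tau : {set V} | tau \in Psi) #|tau|)%N%:Z - 1.

Definition link Psi sigma : {set {set V}} :=
  [set tau : {set V} | [disjoint tau & sigma] & tau :|: sigma \in Psi].

Lemma relative_complex_link Psi sigma :
  relative_complex Psi -> relative_complex (link Psi sigma).
Proof.
move=> PsiP r s t rs st; rewrite !inE => /andP[_ rPsi] /andP[dt tPsi].
rewrite (disjointWl st dt) /=.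
by apply: PsiP rPsi tPsi; apply: setSU.
Qed.

Section Homology.

Variable k : fieldType.

(* All chains, of every degree and for every Psi, live in the free module on
   all subsets of V; [chains Psi i] below cuts out the actual chain groups. *)
Definition chain : Type := {ffun {set V} -> k^o}.

HB.instance Definition _ := Vector.on chain.

Definition basis_chain sigma : chain := [ffun tau => (tau == sigma)%:R].

(* The position of v in sigma, for the vertex order given by [enum_rank]. *)
Definition position sigma (v : V) : nat :=
  #|[set w in sigma | (enum_rank w < enum_rank v)%N]|.

Definition boundary_fun Psi (c : chain) : chain :=
  \sum_(sigma : {set V}) \sum_(v in sigma | sigma :\ v \in Psi)
     (c sigma * (-1) ^+ position sigma v) *: basis_chain (sigma :\ v).

Lemma boundary_fun_is_linear Psi : linear (boundary_fun Psi).
Proof.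
move=> a c1 c2; rewrite /boundary_fun scaler_sumr -big_split /=.
apply: eq_bigr => sigma _; rewrite scaler_sumr -big_split /=.
apply: eq_bigr => v _.
by rewrite !ffunE mulrDl scalerDl scalerA mulrA.
Qed.

HB.instance Definition _ Psi :=
  GRing.isLinear.Build k chain chain *:%R (boundary_fun Psi)
    (boundary_fun_is_linear Psi).

Definition boundary Psi : 'End(chain) := linfun (boundary_fun Psi).

Lemma boundary_basis_chain Psi sigma :
  boundary Psi (basis_chain sigma) =
  \sum_(v in sigma | sigma :\ v \in Psi)
     (-1) ^+ position sigma v *: basis_chain (sigma :\ v).
Proof.
rewrite lfunE /= /boundary_fun (bigD1 sigma) //= [X in _ + X]big1 ?addr0.
  by apply: eq_bigr => v _; rewrite ffunE eqxx mul1r.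
move=> tau /negbTE neq; apply: big1 => v _.
by rewrite ffunE neq mul0r scale0r.
Qed.

Lemma position_setD1 sigma v w : v \in sigma ->
  position sigma w = ((enum_rank v < enum_rank w) + position (sigma :\ v) w)%N.
Proof.
move=> vs; rewrite /position.
rewrite (cardsD1 v [set u in sigma | (enum_rank u < enum_rank w)%N]).
rewrite !inE vs /=; congr (_ + _)%N.
by apply: eq_card => u; rewrite !inE andbA.
Qed.

Lemma boundary_boundary_basis_chain Psi sigma :
  relative_complex Psi -> sigma \in Psi ->
  boundary Psi (boundary Psi (basis_chain sigma)) = 0.
Proof.
move=> PsiP sPsi.
pose P (p : V * V) := [&& p.1 \in sigma, p.2 \in sigma, p.1 != p.2
                        & sigma :\ p.1 :\ p.2 \in Psi].
pose F (p : V * V) : chain :=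
  (-1) ^+ (position sigma p.1 + position (sigma :\ p.1) p.2) *:
    basis_chain (sigma :\ p.1 :\ p.2).
have -> : boundary Psi (boundary Psi (basis_chain sigma)) = \sum_(p | P p) F p.
  rewrite boundary_basis_chain linear_sum /=.
  transitivity (\sum_(v in sigma | sigma :\ v \in Psi)
     \sum_(w in sigma :\ v | sigma :\ v :\ w \in Psi) F (v, w)).
    apply: eq_bigr => v _; rewrite linearZ /= boundary_basis_chain scaler_sumr.
    by apply: eq_bigr => w _; rewrite scalerA -exprD.
  rewrite pair_big_dep /=; apply: eq_big => [[v w]|[v w] _] //.
  rewrite /P /= !inE (eq_sym v w).
  have [vs|] := boolP (v \in sigma) => //=.
  have [->|neq] := eqVneq w v; rewrite ?andbF //=.
  have [ws|] := boolP (w \in sigma); rewrite ?andbF //=.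
  have [vwPsi|] := boolP (sigma :\ v :\ w \in Psi); rewrite ?andbF //= andbT.
  by apply: PsiP vwPsi sPsi; rewrite subsetDl.
have neq_rank (p : V * V) : P p ->
    ~~ (enum_rank p.1 < enum_rank p.2)%N = (enum_rank p.2 < enum_rank p.1)%N.
  case/and4P => _ _ neq _; rewrite -leqNgt leq_eqVlt eq_sym.
  by rewrite (inj_eq val_inj) (inj_eq enum_rank_inj) (negbTE neq).
rewrite (bigID (fun p : V * V => (enum_rank p.1 < enum_rank p.2)%N)) /=.
rewrite [X in _ + X](reindex_inj (h := fun p : V * V => (p.2, p.1))) /=; last first.
  by move=> [a b] [a' b'] [-> ->].
have swap v w : sigma :\ v :\ w = sigma :\ w :\ v.
  by apply/setP => u; rewrite !inE andbCA.
rewrite [X in _ + X](eq_big (fun p => P p && (enum_rank p.1 < enum_rank p.2)%N)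
  (fun p => - F p)) /=; first by rewrite sumrN subrr.
- move=> [v w]; have Psym : P (w, v) = P (v, w).
    by rewrite /P /= andbCA (eq_sym w) swap.
  rewrite /= Psym; have [Pvw|//] := boolP (P (v, w)).
  by rewrite /= (neq_rank (w, v)) ?Psym.
- move=> [v w] /= /andP[Pwv nlt]; have /= [ws vs _ _] := and4P Pwv.
  have lt : (enum_rank v < enum_rank w)%N by rewrite -(neq_rank (w, v)).
  rewrite /F /= swap (position_setD1 w vs) lt (position_setD1 v ws).
  rewrite (leq_gtF (ltnW lt)) add0n add1n addSn exprS mulN1r scaleNr.
  by rewrite addnC.
Qed.

Definition faces Psi (i : int) : {set {set V}} :=
  [set sigma : {set V} in Psi | #|sigma|%:Z == i + 1].

Definition chains Psi (i : int) : {vspace chain} :=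
  <<[seq basis_chain sigma | sigma <- enum (faces Psi i)]>>%VS.

Definition cycles Psi (i : int) : {vspace chain} :=
  (chains Psi i :&: lker (boundary Psi))%VS.

Definition boundaries Psi (i : int) : {vspace chain} :=
  (boundary Psi @: chains Psi (i + 1))%VS.

Lemma boundaries_sub_cycles Psi i :
  relative_complex Psi -> (boundaries Psi i <= cycles Psi i)%VS.
Proof.
move=> PsiP; rewrite /boundaries limg_span; apply/span_subvP => c.
case/mapP => b /mapP[sigma]; rewrite mem_enum inE => /andP[sPsi /eqP cards].
move=> -> ->; rewrite memv_cap memv_ker boundary_boundary_basis_chain // eqxx.
rewrite andbT boundary_basis_chain; apply: rpred_sum => v /andP[vs svPsi].
apply: rpredZ; apply: memv_span; apply: map_f; rewrite mem_enum inE svPsi /=.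
have := cards; rewrite (cardsD1 v sigma) vs add1n => /eqP.
by rewrite -addn1 PoszD (inj_eq (addIr _)).
Qed.

(* The i-th homology Z_i / B_i is zero, i.e. Z_i is contained in B_i. *)
Definition reduced_homology_vanishes Psi (i : int) : Prop :=
  (cycles Psi i <= boundaries Psi i)%VS.

Definition serre Psi (l : int) : Prop :=
  forall sigma tau, tau \in Psi -> sigma \subset tau ->
  forall i : int, i <= Num.min (dim (link Psi sigma)) (l - 1) ->
    reduced_homology_vanishes (link Psi sigma) (i - 1).

Definition relatively_cohen_macaulay Psi : Prop := serre Psi (dim Psi + 1).

End Homology.

Section Balanced.

Variables (d : nat) (kappa : V -> 'I_d).

Record balanced (Phi : {set {set V}}) : Prop := Balanced {
  balanced_neq0 : Phi != set0;
  balanced_relative_complex : relative_complex Phi;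
  balanced_pure : forall rho, rho \in Phi ->
    exists sigma, [/\ sigma \in Phi, rho \subset sigma & #|sigma| = d];
  balanced_inj : forall sigma, sigma \in Phi -> {in sigma &, injective kappa}
}.

Definition color_restriction (Phi : {set {set V}}) (S : {set 'I_d}) :
    {set {set V}} :=
  [set sigma : {set V} in Phi | kappa @: sigma \subset S].

Lemma relative_complex_color_restriction Phi S :
  relative_complex Phi -> relative_complex (color_restriction Phi S).
Proof.
move=> PhiP r s t rs st; rewrite !inE => /andP[rPhi _] /andP[tPhi tS].
by rewrite (PhiP r s t) //= (subset_trans (imsetS kappa st)).
Qed.

End Balanced.

End RelativeComplex.

(* Main.v *)
(* For a colour a outside S, the faces of Phi|_(S + a) that are not in Phi|_S
   are the disjoint union, over the vertices v of colour a, of the cones from v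
   over lk(v), since a face has at most one vertex of colour a.  Hence the long
   exact sequence of the pair reads
     (+)_v H_i(lk v) -> H_i(Phi|_S) -> H_i(Phi|_(S + a)),
   and the same holds inside every link.  Purity gives
   dim lk(v) = dim Phi|_S < dim Phi|_(S + a), so the outer terms vanish in the
   range required by (S_l) for Phi|_S, and colours can be removed one by one. *)
Require Import Defs.
From mathcomp Require Import all_boot all_order all_algebra.

Set Implicit Arguments.
Unset Strict Implicit.
Unset Printing Implicit Defensive.

Import Order.TTheory GRing.Theory Num.Theory.
Local Open Scope ring_scope.

(** * Chains by coefficients, and their parts at a vertex *)

Section Chains.

Variables (k : fieldType) (V : finType).
Implicit Types (Psi : {set {set V}}) (rho sigma tau : {set V}) (c : chain V k).

(** A contribution at [tau] comes from a face [sigma] with [sigma :\ v = tau], which forces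
    [sigma = v |: tau]. A vertex is not counted in its own position, so the sign can be read off
    [tau]. *)
Lemma boundaryE Psi c tau : boundary k Psi c tau =
  if tau \in Psi then
    \sum_(v | v \notin tau) (-1) ^+ position tau v * c (v |: tau)
  else 0.
Proof.
rewrite lfunE /= /boundary_fun sum_ffunE.
pose F sigma v := c sigma * (-1) ^+ position sigma v.
transitivity (\sum_(v : V) \sum_(sigma : {set V} |
    [&& v \in sigma, sigma :\ v \in Psi & sigma :\ v == tau]) F sigma v).
  rewrite (exchange_big_dep xpredT) //=; apply: eq_bigr => sigma _.
  rewrite sum_ffunE [RHS]big_mkcond [LHS]big_mkcond; apply: eq_bigr => v _ /=.
  rewrite !ffunE andbA; case: (_ && _) => //=.
  by rewrite eq_sym; case: eqP => _; rewrite /GRing.scale /= ?mulr1 ?mulr0.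
case: ifP => [tPsi|tNPsi]; last first.
  apply: big1 => v _; apply: big1 => sigma /and3P[_ sPsi /eqP E].
  by rewrite E tNPsi in sPsi.
rewrite [RHS]big_mkcond; apply: eq_bigr => v _ /=.
case: ifP => [vt|/negbFE vt]; last first.
  by apply: big1 => sigma /and3P[_ _ /eqP E]; rewrite -E !inE eqxx in vt.
rewrite (big_pred1 (v |: tau)) => [|sigma]; last first.
  apply/and3P/eqP => [[vs _ /eqP <-]|->]; first by rewrite setD1K.
  by rewrite setU11 setU1K.
rewrite /F mulrC (position_setD1 v (setU11 v tau)) ltnn add0n.
by rewrite setU1K.
Qed.

(** Basis chains are indicator functions, so membership in their span is a condition on the
    support. *)
Lemma chainsP Psi (i : int) c :
  reflect (forall sigma, sigma \notin faces Psi i -> c sigma = 0)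
          (c \in chains k Psi i).
Proof.
apply: (iffP idP) => [cP sigma sN|c0].
  pose X := [seq basis_chain k s | s <- enum (faces Psi i)].
  rewrite (coord_span (X := in_tuple X) cP : c = _).
  rewrite sum_ffunE; apply: big1 => j _.
  rewrite ffunE; have := mem_nth 0 (ltn_ord j).
  case/mapP => tau; rewrite mem_enum => tP ->.
  rewrite ffunE; case: eqP => [E|_]; first by rewrite E tP in sN.
  by rewrite scaler0.
have -> : c = \sum_(sigma in faces Psi i) c sigma *: basis_chain k sigma.
  apply/ffunP => tau; rewrite sum_ffunE.
  case: (boolP (tau \in faces Psi i)) => [tP|tN].
    rewrite (bigD1 tau) //= big1 ?addr0 => [|s /andP[_ /negbTE sN]].
      by rewrite !ffunE eqxx /GRing.scale /= mulr1.
    by rewrite !ffunE eq_sym sN scaler0.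
  rewrite c0 // big1 // => s sP; rewrite !ffunE; case: eqP => [E|_].
    by rewrite E sP in tN.
  by rewrite scaler0.
apply: rpred_sum => s sP; apply: rpredZ; apply: memv_span.
by apply: map_f; rewrite mem_enum.
Qed.

Lemma faces_setU1 Psi (i : int) v tau : v \notin tau ->
  (v |: tau \in faces Psi (i + 1)) = (tau \in faces (link Psi [set v]) i).
Proof.
move=> vt; rewrite !inE disjoint_sym disjoints1 vt /= [tau :|: _]setUC.
by rewrite cardsU1 vt addnC PoszD (inj_eq (addIr _)).
Qed.

(** Exactly one of [v] and [w] precedes the other, so inserting one shifts the position of the other
    in just one of the two orders. *)
Lemma position_swap tau v w : v \notin tau -> w \notin tau -> v != w ->
  (-1) ^+ position tau w * (-1) ^+ position (w |: tau) v =
  - ((-1) ^+ position tau v * (-1) ^+ position (v |: tau) w) :> k.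
Proof.
move=> vt wt neq; rewrite (position_setD1 w (setU11 v tau)).
rewrite (position_setD1 v (setU11 w tau)) !setU1K //.
have : (enum_rank v == enum_rank w :> nat) = false.
  by rewrite (inj_eq val_inj) (inj_eq enum_rank_inj) (negbTE neq).
rewrite !exprD mulrC; case: ltngtP => //= _ _; rewrite ?expr0 ?expr1 !mul1r.
  by rewrite mulN1r mulNr.
by rewrite mulN1r mulrN opprK.
Qed.

Lemma position_sign_sqr tau v :
  (-1) ^+ position tau v * (-1) ^+ position tau v = 1 :> k.
Proof. by rewrite -expr2 sqrr_sign. Qed.

(* The sign makes c the join of v with this chain of lk(v), on faces
   through v. *)
Definition link_part c v : chain V k :=
  [ffun tau : {set V} => if v \in tau then 0 : k^o
               else (-1) ^+ position tau v * c (v |: tau)].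

(** This is the Leibniz rule d(v * x) = x - v * dx for a join, read on faces through [v], where only
    the last term contributes. *)
Lemma boundary_link_part Psi c v tau : relative_complex Psi ->
  tau \in link Psi [set v] ->
  boundary k (link Psi [set v]) (link_part c v) tau =
  - (-1) ^+ position tau v * boundary k Psi c (v |: tau).
Proof.
move=> PsiP tL; have := tL; rewrite inE setUC => /andP[].
rewrite disjoint_sym disjoints1 => vt vtPsi.
rewrite !boundaryE tL vtPsi mulr_sumr [LHS](bigD1 v) //= ffunE setU11.
rewrite mulr0 add0r.
apply: eq_big => [w|w /andP[wt wv]]; first by rewrite !inE negb_or andbC.
rewrite ffunE !inE (negbTE vt) eq_sym (negbTE wv) /= setUCA !mulrA.
congr (_ * _); rewrite mulNr; by apply: position_swap; rewrite // eq_sym.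
Qed.

Lemma mem_cycles Psi (i : int) c :
  (c \in cycles k Psi i) = (c \in chains k Psi i) && (boundary k Psi c == 0).
Proof. by rewrite memv_cap memv_ker. Qed.

Lemma vanishing_filling Psi (i : int) c : reduced_homology_vanishes k Psi i ->
  c \in chains k Psi i -> boundary k Psi c = 0 ->
  exists2 b, b \in chains k Psi (i + 1) & c = boundary k Psi b.
Proof.
move=> /subvP H cP c0; have /H/memv_imgP[b bP ->] : c \in cycles k Psi i.
  by rewrite mem_cycles cP c0 eqxx.
by exists b.
Qed.

(** * Removing a vertex set that meets each face at most once *)

Definition avoiding Psi (W : {set V}) := [set tau in Psi | [disjoint tau & W]].

(* Exactness at H_i(avoiding Psi W), on chains: if z is the boundary of w in
   Psi, the part of w through each v in W is v joined with a cycle of lk(v);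
   fill it by x v.  Adding to w the boundary of the sum y of the joins of v with
   x v cancels every face of w meeting W without changing the boundary of w. *)
Lemma vanishing_avoiding Psi (W : {set V}) (i : int) :
  relative_complex Psi ->
  (forall sigma, sigma \in Psi -> {in W :&: sigma &, forall v w, v = w}) ->
  reduced_homology_vanishes k Psi i ->
  (forall v, v \in W -> reduced_homology_vanishes k (link Psi [set v]) i) ->
  reduced_homology_vanishes k (avoiding Psi W) i.
Proof.
move=> PsiP W1 HPsi Hlk; apply/subvP => z; rewrite mem_cycles.
set A := avoiding Psi W => /andP[/chainsP zA /eqP bz].
have AE tau : (tau \in A) = (tau \in Psi) && [disjoint tau & W] by rewrite inE.
have facesA j tau :
    (tau \in faces A j) = (tau \in faces Psi j) && [disjoint tau & W].
  by rewrite !inE andbAC.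
have NA v tau : v \in W -> v \in tau -> [disjoint tau & W] = false.
  by move=> vW vt; apply/negbTE/pred0Pn; exists v; rewrite /= vt.
have [w wP zw] : exists2 w, w \in chains k Psi (i + 1) & z = boundary k Psi w.
  apply: vanishing_filling => //.
    by apply/chainsP => s sN; apply: zA; rewrite facesA (negbTE sN).
  apply/ffunP => tau; rewrite boundaryE ffunE; case: ifP => // tPsi.
  have /ffunP/(_ tau) := bz; rewrite boundaryE ffunE AE tPsi /=.
  (* If [tau] meets [W], so does every [v |: tau], and [z] vanishes there. *)
  case: (boolP [disjoint tau & W]) => //= tW _; apply: big1 => v vt.
  have [u ut uW] : exists2 u, u \in tau & u \in W.
    by move/pred0Pn: tW => [u /andP[ut uW]]; exists u.
  by rewrite zA ?mulr0 // facesA (NA u) ?andbF // inE ut orbT.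
(* Membership in [W] is a premise under the existential, so that finite choice yields a family over
   all of [V]; vertices outside [W] get the dummy 0. *)
have Hx v : exists x, v \in W -> x \in chains k (link Psi [set v]) (i + 1) /\
    link_part w v = boundary k (link Psi [set v]) x.
  have [vW|] := boolP (v \in W); last by exists 0.
  have [||x xP xE] := vanishing_filling (c := link_part w v) (Hlk v vW).
  - apply/chainsP => s sN; rewrite ffunE; case: ifP => // /negbT vs.
    by move/chainsP: wP => ->; rewrite ?mulr0 // faces_setU1.
  - apply/ffunP => tau; have [tL|tL] := boolP (tau \in link Psi [set v]).
      (* Up to sign, this is a coefficient of [z] at a face through [v], hence 0. *)
      rewrite boundary_link_part // -zw zA ?mulr0 ?ffunE //.
      by rewrite facesA (NA v) ?andbF ?setU11.
    by rewrite boundaryE (negbTE tL) ffunE.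
  by exists x.
have [x xP] := fin_all_exists Hx.
(* On a face of [Psi] the sum has at most one term, by [W1]; off [Psi] every term is 0, since [x v]
   is supported on the link of [v]. *)
pose y : chain V k := [ffun sigma : {set V} => \sum_(v in W :&: sigma)
  (-1) ^+ position sigma v * x v (sigma :\ v) : k^o].
have yP : y \in chains k Psi (i + 1 + 1).
  apply/chainsP => s sN; rewrite ffunE big1 // => v /setIP[vW vs].
  have [/chainsP-> //] := xP v vW; first by rewrite mulr0.
  by rewrite -faces_setU1 ?setD1K // !inE eqxx.
have lpy v : v \in W -> link_part y v = x v.
  move=> vW; have [/chainsP xvP _] := xP v vW; apply/ffunP => tau.
  rewrite ffunE.
  case: ifP => [vt|/negbT vt].
    by rewrite xvP // !inE disjoint_sym disjoints1 vt.
  have [vtPsi|vtPsi] := boolP (v |: tau \in faces Psi (i + 1 + 1)); last first.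
    by move/chainsP: yP => -> //; rewrite mulr0 xvP // -faces_setU1.
  have vI : v \in W :&: (v |: tau) by rewrite !inE eqxx vW.
  rewrite ffunE (big_pred1 v) => [|u].
    rewrite setU1K // (position_setD1 v (setU11 v tau)) ltnn add0n setU1K //.
    by rewrite mulrA position_sign_sqr mul1r.
  apply/idP/eqP => [uI|-> //]; apply: W1 uI vI.
  by move: vtPsi; rewrite inE => /andP[].
have byP : boundary k Psi y \in cycles k Psi (i + 1).
  by apply: (subvP (boundaries_sub_cycles k (i + 1) PsiP)); apply: memv_img.
move: byP; rewrite mem_cycles => /andP[byP /eqP bby].
have w'P : w + boundary k Psi y \in chains k A (i + 1).
  apply/chainsP => s sN.
  have [sP|sN'] := boolP (s \in faces Psi (i + 1)); last first.
    by move/chainsP: (rpredD wP byP) => ->.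
  move: sN; rewrite facesA sP /= => /pred0Pn[v /andP[/= vs vW]].
  have sPsi : s \in Psi by move: sP; rewrite inE => /andP[].
  have [_ wx] := xP v vW.
  have tL : s :\ v \in link Psi [set v].
    by rewrite !inE disjoint_sym disjoints1 !inE eqxx setUC setD1K.
  (* As the boundary of [x v] is [link_part w v], this equates a sign times [w s] with minus the
     same sign times the boundary of [y] at [s]. *)
  have := boundary_link_part y PsiP tL.
  rewrite lpy // -wx !ffunE !inE eqxx /= setD1K // mulNr -mulrN.
  move/(mulrI (unitrX _ (unitrN1 _))) => ->; exact: addNr.
apply/memv_imgP; exists (w + boundary k Psi y) => //.
have zE : z = boundary k Psi (w + boundary k Psi y).
  by rewrite linearD /= bby addr0.
(* By [boundaryE] the complex only selects where the boundary is kept, so the boundaries in [A] and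
   in [Psi] agree on [A]; outside [A] both sides are 0. *)
apply/ffunP => tau; rewrite [RHS]boundaryE; case: ifP => tA.
  by rewrite zE boundaryE; move: tA; rewrite AE => /andP[->].
by rewrite zA // inE tA.
Qed.

Lemma vanishing_set0 (i : int) :
  reduced_homology_vanishes k (set0 : {set {set V}}) i.
Proof.
apply/subvP => c; rewrite mem_cycles => /andP[/chainsP c0 _].
suff -> : c = 0 by apply: mem0v.
by apply/ffunP => s; rewrite ffunE c0 // !inE.
Qed.

Lemma link_avoiding Psi (W : {set V}) sigma : [disjoint sigma & W] ->
  link (avoiding Psi W) sigma = avoiding (link Psi sigma) W.
Proof.
move=> sW; apply/setP => tau; rewrite !inE -!setI_eq0 setIUl setU_eq0.
by rewrite (eqP (_ : sigma :&: W == set0)) ?setI_eq0 // eqxx andbT andbA.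
Qed.

Lemma link_link Psi sigma rho : [disjoint rho & sigma] ->
  link (link Psi sigma) rho = link Psi (rho :|: sigma).
Proof.
move=> rs; apply/setP => tau; rewrite !inE setUA.
rewrite -!setI_eq0 setIUr setIUl !setU_eq0 !setI_eq0 rs andbT.
by rewrite andbA.
Qed.

Lemma serre_leq Psi (l m : int) : l <= m -> serre k Psi m -> serre k Psi l.
Proof.
move=> lm H sigma tau tP st i; rewrite le_min => /andP[iD il].
apply: (H sigma tau) => //; rewrite le_min iD.
by apply: le_trans il _; rewrite lerD2r.
Qed.

End Chains.

(** * Links and Serre's condition under restriction of colours *)

Section ColorRestriction.

Variables (k : fieldType) (V : finType) (d : nat) (kappa : V -> 'I_d).
Variable Phi : {set {set V}}.
Hypothesis PhiB : balanced kappa Phi.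
Implicit Types (S : {set 'I_d}) (sigma tau : {set V}).

Lemma mem_color_restriction S tau :
  (tau \in color_restriction kappa Phi S) =
  (tau \in Phi) && (tau \subset kappa @^-1: S).
Proof. by rewrite inE sub_imset_pre. Qed.

(** Injectivity of the colouring gives the upper bound. For equality, purity extends [tau] to a face
    with [d] vertices, which has every colour once; its vertices with colour in [S] form a face of
    size [#|S|] containing [sigma]. *)
Lemma dim_link_color_restriction S sigma tau :
  tau \in color_restriction kappa Phi S -> sigma \subset tau ->
  Defs.dim (link (color_restriction kappa Phi S) sigma) =
  #|S|%:Z - #|sigma|%:Z - 1.
Proof.
have [_ PhiP pure inj] := PhiB.
rewrite mem_color_restriction => /andP[tPhi tS] st.
rewrite /Defs.dim; congr (_ - 1).
have cardS rho : rho \in Phi -> rho \subset kappa @^-1: S -> (#|rho| <= #|S|)%N.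
  move=> /inj rinj rS; rewrite -(card_in_imset rinj).
  by apply: subset_leq_card; rewrite sub_imset_pre.
have sS : (#|sigma| <= #|S|)%N.
  exact: leq_trans (subset_leq_card st) (cardS _ tPhi tS).
rewrite subzn //; congr Posz.
apply/eqP; rewrite eqn_leq; apply/andP; split.
  apply/bigmax_leqP => rho; rewrite inE mem_color_restriction.
  rewrite -setI_eq0 => /and3P[/eqP drs rsPhi rsS].
  by rewrite leq_subRL // addnC -cardsUI drs cards0 addn0 cardS.
have [rho [rPhi tr cr]] := pure _ tPhi.
pose rS := rho :&: kappa @^-1: S.
have trS : tau \subset rS by rewrite subsetI tr tS.
have srS := subset_trans st trS.
have rSPhi : rS \in Phi by apply: PhiP tPhi rPhi; rewrite ?subsetIl.
have krho : kappa @: rho = setT.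
  apply/eqP; rewrite eqEcard subsetT cardsT card_ord.
  by rewrite (card_in_imset (inj _ rPhi)) cr leqnn.
have <- : #|rS| = #|S|.
  rewrite -(card_in_imset (inj _ rSPhi)); congr #|pred_of_set _|.
  apply/setP => a.
  apply/imsetP/idP => [[v /setIP[_]]|aS]; first by rewrite inE => vS ->.
  have : a \in kappa @: rho by rewrite krho inE.
  by case/imsetP => v vr aE; exists v => //; rewrite !inE vr -aE.
have <- : #|rS :\: sigma| = (#|rS| - #|sigma|)%N.
  by rewrite cardsD (setIidPr srS).
apply: (@leq_bigmax_cond _ _ (fun rho : {set V} => #|rho|) (rS :\: sigma)).
have rSE : rS :\: sigma :|: sigma = rS.
  by rewrite setUC -{1}(setIidPr srS) setID.
rewrite inE mem_color_restriction rSE rSPhi subsetIr !andbT.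
by rewrite -setI_eq0 setDE -setIA [_ :&: sigma]setIC setICr setI0.
Qed.

Lemma serre_color_restriction_setU1 S a (l : int) : a \notin S ->
  serre k (color_restriction kappa Phi (a |: S)) l ->
  serre k (color_restriction kappa Phi S) l.
Proof.
have [_ PhiP _ inj] := PhiB.
move=> aS HPsi sigma tau tP st i.
set Psi := color_restriction kappa Phi (a |: S) in HPsi *.
pose W := kappa @^-1: [set a].
have PsiP : relative_complex Psi by apply: relative_complex_color_restriction.
have disjW rho : rho \in color_restriction kappa Phi S -> [disjoint rho & W].
  rewrite mem_color_restriction => /andP[_ /subsetP rS]; apply/pred0P => v /=.
  apply/andP => -[/rS]; rewrite !inE => vS /eqP vE.
  by rewrite -vE vS in aS.
have SE : color_restriction kappa Phi S = avoiding Psi W.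
  apply/setP => rho; apply/idP/idP => [rP|].
    rewrite inE (disjW _ rP) andbT; move: rP.
    rewrite !mem_color_restriction => /andP[-> rS] /=.
    by apply: subset_trans rS (preimsetS _ _); apply: subsetUr.
  rewrite inE !mem_color_restriction.
  case/andP=> /andP[-> /subsetP raS] /pred0P dW /=; apply/subsetP => v vr.
  by have := raS v vr; have := dW v; rewrite !inE /= vr /= => ->.
have sW : [disjoint sigma & W] by apply: disjointWl st (disjW _ tP).
have tPsi : tau \in Psi by move: tP; rewrite SE inE => /andP[].
rewrite (dim_link_color_restriction tP st) SE link_avoiding // le_min.
case/andP=> iS il; apply: vanishing_avoiding.
- exact: relative_complex_link.
- move=> rho; rewrite inE mem_color_restriction => /and3P[_ /inj rinj _] v w.
  rewrite !inE => /andP[/eqP va vr] /andP[/eqP wa wr].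
  by apply: rinj; rewrite ?inE ?vr ?wr // va wa.
- apply: (HPsi sigma tau) => //; rewrite le_min il andbT.
  rewrite (dim_link_color_restriction tPsi st) cardsU1 aS.
  by apply: le_trans iS _; rewrite !lerD2r lez_nat leqnSn.
move=> v vW; have vs : v \notin sigma.
  by apply: contraL vW => vs; rewrite (disjointFr sW vs).
rewrite link_link ?disjoints1 //.
(* If [v |: sigma] lies in no face, (S_l) says nothing about it, but its link is empty. *)
have [->|[rho]] := set_0Vmem (link Psi (v |: sigma)).
  exact: vanishing_set0.
rewrite inE => /andP[_ rPsi].
have vsr : v |: sigma \subset rho :|: (v |: sigma) by apply: subsetUr.
apply: (HPsi _ _ rPsi vsr); rewrite le_min il andbT.
(* The added colour and the added vertex cancel in the dimension formula. *)
rewrite (dim_link_color_restriction rPsi vsr) !cardsU1 aS vs !PoszD.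
by rewrite opprD addrACA subrr add0r.
Qed.

Lemma serre_color_restriction S (l : int) :
  serre k Phi l -> serre k (color_restriction kappa Phi S) l.
Proof.
(* Induction on the number of colours missing from [S]. *)
move=> HPhi; have [n] := ubnP #|~: S|; elim: n S => // n IHn S Sn.
have [->|] := eqVneq S setT.
  suff -> : color_restriction kappa Phi setT = Phi by [].
  by apply/setP => tau; rewrite inE subsetT andbT.
rewrite -properT => /properP[_ [a _ aS]].
apply: (serre_color_restriction_setU1 aS); apply: IHn; rewrite -ltnS.
apply: leq_trans Sn; rewrite setCU (cardsD1 a (~: S)) inE aS add1n.
by rewrite setDE setIC.
Qed.

End ColorRestriction.

Theorem theorem1p2 (k : fieldType) (V : finType) (d : nat) (kappa : V -> 'I_d)
    (Phi : {set {set V}}) (hPhi : balanced kappa Phi) :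
  (forall l : int, serre k Phi l ->
     forall S : {set 'I_d}, serre k (color_restriction kappa Phi S) l) /\
  (relatively_cohen_macaulay k Phi ->
     forall S : {set 'I_d},
       relatively_cohen_macaulay k (color_restriction kappa Phi S)).
Proof.
split=> [l HPhi S|HPhi S]; first exact: serre_color_restriction.
(* Restriction cannot raise the dimension, so the condition for [dim Phi + 1] is at least as strong
   as the one required. *)
apply: (serre_leq (m := Defs.dim Phi + 1)); last exact: serre_color_restriction.
rewrite !lerD2r lez_nat; apply/bigmax_leqP => tau; rewrite inE => /andP[tPhi _].
exact: (@leq_bigmax_cond _ _ (fun rho : {set V} => #|rho|) tau).
Qed.
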